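(* Let $d\ge 1$ be an integer, let $A\subseteq\mathbb{R}^d$, let $0<\delta\le d$, and let $\rho_0>0$ and $\vec\beta=(\beta_i)_{i\in\mathbb{N}}$ be admissible game parameters (as defined in the context). If player I has a winning strategy in the $\delta$-Hausdorff dimension game $G^{\delta}_{\vec\beta}(A)$ with target set $A$, then there is a compact set $K\subseteq A$ with $\mathrm{HD}(K)\ge\delta$.
   Context: $\mathrm{HD}$ denotes Hausdorff dimension of subsets of $\mathbb{R}^d$ (Euclidean metric), defined for arbitrary subsets. $B(x,r)$ denotes the closed ball of radius $r$ centred at $x$. A set is $r$-separated if any two distinct points of it are at distance at least $r$. $|F|$ is the cardinality of a finite set $F$. Admissible game parameters: a real $\rho_0>0$ and a sequence $(\beta_i)_{i\in\mathbb{N}}$ of reals with $0<\beta_{i+1}\le\beta_i<\frac12$ for all $i$, $\lim_{i\to\infty}\beta_i=0$, and $$\forall\eta>0\ \exists n_0\ \forall n\ge n_0\quad \beta_n\ge\prod_{i<n}\beta_i^{\eta}.$$ Put $\rho_n=\left(\prod_{i<n}\beta_i\right)\rho_0$. The $\delta$-Hausdorff dimension game $G^{\delta}_{\vec\beta}(A)$ ($A\subseteq\mathbb{R}^d$, $0<\delta\le d$): players I and II alternate moves $F_0,x_0,F_1,x_1,F_2,x_2,\dots$, where I plays the $F_i$ and II plays the $x_i$. Player I must follow these rules: (a) each $F_i$ is a finite nonempty set of points of $\mathbb{Q}^d$; (b) each $F_i$ is $3\rho_i$-separated; (c) $F_{i+1}\subseteq B(x_i,(1-\beta_i)\rho_i)$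 for all $i$; (d) there is some $c>0$ such that $\displaystyle\limsup_{n\to\infty}\frac{\prod_{i<n}|F_i|^{-1}}{\prod_{i<n}\beta_i^{\delta}}\le c$. Player II must play $x_i\in F_i$ for every $i$. A player who violates these requirements loses (the first to violate (a), (b), (c) or II's requirement loses; if only (d) is violated, I loses). If the players meet these requirements, player I wins if and only if $\lim_{n\to\infty}x_n\in A$; otherwise II wins. *)

(* Defs.v *)
From mathcomp Require Import all_boot all_order all_algebra.
From mathcomp Require Import finmap.
From mathcomp Require Import all_classical all_reals all_analysis.

Set Implicit Arguments.
Unset Strict Implicit.
Unset Printing Implicit Defensive.

Import Order.TTheory GRing.Theory Num.Theory.
Import numFieldNormedType.Exports.

Local Open Scope classical_set_scope.
Local Open Scope ring_scope.

(** R^d is ['rV[R]_d]. The library puts the sup norm on it; its topology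
    (used below for limits and for compactness) is the Euclidean one, but
    distances, balls and diameters have to be Euclidean, hence [edist]. *)
Definition edist (R : realType) (d : nat) (x y : 'rV[R]_d) : R :=
  Num.sqrt (\sum_(i < d) (x ord0 i - y ord0 i) ^+ 2).

Definition eball (R : realType) (d : nat) (x : 'rV[R]_d) (r : R) :
    set 'rV[R]_d :=
  [set y | edist x y <= r].

Definition separated (R : realType) (d : nat) (r : R)
    (F : {fset 'rV[R]_d}) : Prop :=
  forall p q, p \in F -> q \in F -> p != q -> r <= edist p q.

Section HausdorffDimension.
Context (R : realType) (d : nat).
Implicit Types (U E : set 'rV[R]_d) (s e : R).

(** The diameter of [set0] is [-oo]; it satisfies every bound [<= e], and
    [hausdorff_weight] does not use it. *)
Definition ediam U : \bar R :=
  ereal_sup [set (edist p.1 p.2)%:E | p in U `*` U].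

(** diam(U)^s, with the convention that the empty set has weight 0, also for
    s = 0. For nonempty [U], [0 `^ 0 = 1]. *)
Definition hausdorff_weight s U : \bar R :=
  (if U == set0 then 0 else ediam U `^ s)%E.

Definition hausdorff_premeasure s e E : \bar R :=
  ereal_inf [set (\sum_(0 <= k <oo) hausdorff_weight s (U k))%E
            | U in [set U : (set 'rV[R]_d)^nat |
                     E `<=` \bigcup_k U k
                     /\ forall k, (ediam (U k) <= e%:E)%E]].

Definition hausdorff_measure s E : \bar R :=
  ereal_sup [set hausdorff_premeasure s e E | e in [set e | 0 < e]].

Definition hausdorff_dim E : \bar R :=
  ereal_inf [set s%:E | s in [set s | 0 <= s /\ hausdorff_measure s E = 0%E]].

End HausdorffDimension.

Definition admissible (R : realType) (rho0 : R) (beta : R^nat) : Prop :=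
  [/\ 0 < rho0,
      forall i, 0 < beta i.+1 <= beta i /\ beta i < 2^-1,
      beta @ \oo --> (0 : R)
    & forall eta : R, 0 < eta ->
        exists n0, forall n, (n0 <= n)%N ->
          \prod_(i < n) (beta i `^ eta) <= beta n].

Section Game.
Context (R : realType) (d : nat).
Variables (delta rho0 : R) (beta : R^nat) (A : set 'rV[R]_d).

Definition rho (n : nat) : R := (\prod_(i < n) beta i) * rho0.

(** An infinite run is a pair of sequences [F], [x]. Moves are not constrained
    by typing (apart from finiteness of [F n]): a run may contain illegal moves,
    and then the first player to have made one loses. *)
Implicit Types (F : nat -> {fset 'rV[R]_d}) (x : nat -> 'rV[R]_d).

Definition legal_I F x (n : nat) : Prop :=
  [/\ F n != fset0,
      [set` F n] `<=` range (map_mx (@ratr R) : 'rV[rat]_d -> 'rV[R]_d),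
      separated (3 * rho n) (F n)
    & forall m, n = m.+1 ->
        [set` F n] `<=` eball (x m) ((1 - beta m) * rho m)].

Definition legal_II F x (n : nat) : Prop := x n \in F n.

Definition size_rule F : Prop :=
  exists2 c : R, 0 < c &
    (limn_esup (fun n =>
       ((\prod_(i < n) (#|` F i |%:R)^-1)
        / (\prod_(i < n) (beta i `^ delta)))%:E) <= c%:E)%E.

Definition II_violates_first F x : Prop :=
  exists n, [/\ forall i, (i <= n)%N -> legal_I F x i,
                forall i, (i < n)%N -> legal_II F x i
              & ~ legal_II F x n].

(** The rules force [x] to be Cauchy, so that the limit exists in the second
    case. *)
Definition I_wins F x : Prop :=
  II_violates_first F x
  \/ [/\ forall n, legal_I F x n, forall n, legal_II F x n, size_rule F
       & exists2 a, A a & x @ \oo --> a].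

(** A strategy for player I maps the position
    (F_0, x_0), ..., (F_(n-1), x_(n-1)) to the move F_n. *)
Definition strategy_I := seq ({fset 'rV[R]_d} * 'rV[R]_d) -> {fset 'rV[R]_d}.

Definition follows (sigma : strategy_I) F x : Prop :=
  forall n, F n = sigma (mkseq (fun i => (F i, x i)) n).

Definition winning_I (sigma : strategy_I) : Prop :=
  forall F x, follows sigma F x -> I_wins F x.

Definition I_has_winning_strategy : Prop := exists sigma, winning_I sigma.

End Game.

(* Main.v *)
Require Import Defs.
From mathcomp Require Import all_boot all_order all_algebra.
From mathcomp Require Import finmap.
From mathcomp Require Import ring lra.
From mathcomp Require Import all_classical all_reals all_analysis.

Set Implicit Arguments.
Unset Strict Implicit.
Unset Printing Implicit Defensive.

Import Order.TTheory GRing.Theory Num.Theory.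
Import numFieldNormedType.Exports.

Local Open Scope classical_set_scope.
Local Open Scope ring_scope.

(** Fix a winning strategy of player I. The positions that player II can reach
    by legal moves form a finitely branching tree, and [K] is the set of limits
    of its branches. It is contained in the target set because every branch is
    a legal run, which player I wins.

    The moves offered at stage [n] are [3 * rho n]-separated, and a branch ends
    up within [rho n] of its choice number [n]. Two branches whose limits are
    closer than [rho n] therefore agree up to that choice ([branch_eq]). This
    makes [K] closed, by a diagonal argument ([limit_set_closed]), and it
    reduces covers of [K] to families of positions: if [U] has diameter less
    than [rho n] and at least [rho n.+1], then all branches with limit in [U]
    pass through a single position of length [n.+1].

    For the lower bound on the dimension, give a position the mass that it has
    when player II plays at random, uniformly among the offered moves. The rule
    on the number of moves bounds the mass of a position of length [n] by
    [C * rho n `^ delta], with a constant that depends on the run; by a Baire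
    category argument the constant is uniform beyond some position [s]
    ([uniform_mass_bound]). Thus the single position attached to [U] has mass
    at most [C] times the power [delta] of the diameter of [U]
    ([small_set_node]). If the [q]-dimensional Hausdorff measure of [K] vanished
    for some [q < delta], then [K] would have a cover whose positions have total
    mass less than that of [s]. Mass is additive, so a branch through [s] that
    avoids all these positions can be chosen greedily ([branch_avoiding]), and
    its limit is not covered. No measure on [K] has to be constructed. *)

(* Unqualified, the name denotes the extended distance of a pseudometric
   space. *)
Local Notation edist := Defs.edist.

(** * Branches of finitely branching trees *)

(** Dependent choice for sequences. A step may append several entries, which
    is what [uniform_mass_bound] needs; the counter [k] lets the property
    become more demanding at every step. *)
Lemma dependent_branch (T : eqType) (P : nat -> seq T -> Prop) (s0 : seq T) :
  P 0%N s0 ->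
  (forall k s, P k s -> exists y u, P k.+1 (s ++ y :: u)) ->
  exists x : nat -> T, mkseq x (size s0) = s0 /\
    forall k, exists2 n, (size s0 + k <= n)%N & P k (mkseq x n).
Proof.
move=> P0 Pstep.
pose step (a b : nat * seq T) := P a.1 a.2 ->
  [/\ b.1 = a.1.+1, P b.1 b.2 & exists y u, b.2 = a.2 ++ y :: u].
have stepex a : {b | step a b}.
  apply: cid; have [Pa|nPa] := pselect (P a.1 a.2); last by exists a => /nPa.
  have [y [u Pb]] := Pstep _ _ Pa; exists (a.1.+1, a.2 ++ y :: u) => _.
  by split=> //; exists y, u.
have [f [f0 fstep]] := dependent_choice stepex (0%N, s0).
have fP k : (f k).1 = k /\ P k (f k).2.
  elim: k => [|k [IH1 IH2]]; first by rewrite f0.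
  by have := fstep k; rewrite /step IH1 => /(_ IH2)[e]; rewrite e.
have fS k : exists y u, (f k.+1).2 = (f k).2 ++ y :: u.
  by have [fk Pk] := fP k; have := fstep k; rewrite /step fk => /(_ Pk)[].
have fpre m n : (m <= n)%N -> prefix (f m).2 (f n).2.
  move=> /subnK<-; elim: (n - m)%N => [|k IH]; first exact: prefix_refl.
  by rewrite addSn; have [y [u ->]] := fS (k + m)%N; exact: prefix_catl.
have fsize k : (size s0 + k <= size (f k).2)%N.
  elim: k => [|k IH]; first by rewrite f0 addn0.
  have [y [u ->]] := fS k; rewrite size_cat /= !addnS ltnS.
  exact: leq_trans IH (leq_addr _ _).
have [z0 _] := fS 0%N.
pose x i := nth z0 (f i.+1).2 i.
have fx k : (f k).2 = mkseq x (size (f k).2).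
  apply: (@eq_from_nth _ z0); rewrite ?size_mkseq // => i ik.
  rewrite nth_mkseq // /x; have isz : (i < size (f i.+1).2)%N.
    by apply: leq_trans (fsize i.+1); rewrite addnS ltnS leq_addl.
  have [/fpre|/ltnW/fpre] := leqP k i.+1; rewrite prefixE => /eqP<-;
    by rewrite nth_take.
exists x; split=> [|k]; first by have := fx 0%N; rewrite f0.
by exists (size (f k).2) => //; rewrite -fx; have [] := fP k.
Qed.

Section Tree.
Context (R : realType) (T : choiceType) (move : seq T -> {fset T}).
Implicit Types (s t : seq T) (x : nat -> T).

(** A node is the finite sequence of choices that leads to it. *)
Definition node s := forall s' y, prefix (rcons s' y) s -> y \in move s'.

Definition branch x := forall n, x n \in move (mkseq x n).

(** The probability of passing through [s] when every successor is drawn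
    uniformly. *)
Definition mass s : R := \prod_(i < size s) (#|` move (take i s)|%:R)^-1.

Lemma node_nil : node [::].
Proof. by move=> s' y; rewrite prefixs0; case: s'. Qed.

Lemma node_prefix s t : prefix s t -> node t -> node s.
Proof. by move=> st nt s' y /prefix_trans/(_ st)/nt. Qed.

Lemma node_rcons s y : node (rcons s y) <-> node s /\ y \in move s.
Proof.
split=> [ns|[ns ys] s' z].
  split; last by apply: ns; exact: prefix_refl.
  by apply: node_prefix ns; exact: prefix_rcons.
move=> /prefixP[u]; case/lastP: u => [|u w].
  by rewrite cats0 => /rcons_inj[<- <-].
by rewrite -rcons_cat => /rcons_inj[e _]; apply: ns; rewrite e prefix_prefix.
Qed.

Lemma prefix_mkseq x m n : (m <= n)%N -> prefix (mkseq x m) (mkseq x n).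
Proof.
by move=> mn; rewrite prefixE size_mkseq -map_take take_iota (minn_idPl mn).
Qed.

Lemma branch_node x n : branch x -> node (mkseq x n).
Proof.
move=> bx; elim: n => [|n IH]; first exact: node_nil.
by rewrite mkseqS; apply/node_rcons.
Qed.

Lemma node_branch x :
  (forall m, exists2 n, (m <= n)%N & node (mkseq x n)) -> branch x.
Proof.
move=> xn m; have [n mn /(node_prefix (prefix_mkseq x mn))] := xn m.+1.
by rewrite mkseqS => /node_rcons[].
Qed.

Lemma mass_ge0 s : 0 <= mass s.
Proof. by apply: prodr_ge0 => i _; rewrite invr_ge0. Qed.

Lemma mass_rcons s y : mass (rcons s y) = mass s * (#|` move s|%:R)^-1.
Proof.
rewrite /mass size_rcons big_ord_recr /= -cats1 take_size_cat //.
by congr (_ * _); apply: eq_bigr => i _; rewrite takel_cat // ltnW.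
Qed.

Hypothesis move_neq0 : forall s, node s -> move s != fset0.

Lemma mass_gt0 s : node s -> 0 < mass s.
Proof.
move=> ns; apply: prodr_gt0 => i _; rewrite invr_gt0 ltr0n cardfs_gt0.
by apply: move_neq0; apply: node_prefix ns; exact: prefix_take.
Qed.

Lemma sum_mass_rcons s : node s -> \sum_(y <- move s) mass (rcons s y) = mass s.
Proof.
move=> ns; under eq_bigr do rewrite mass_rcons.
rewrite big_const_seq count_predT iter_addr_0 -[LHS]mulr_natr -mulrA mulVf ?mulr1 //.
by rewrite pnatr_eq0 -lt0n cardfs_gt0; exact: move_neq0.
Qed.

Lemma sum_children (c : \bar R) s t : (0 <= c)%E ->
  (\sum_(y <- move s) (if prefix (rcons s y) t then c else 0)
     <= (if prefix s t then c else 0))%E.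
Proof.
move=> c0; have [/prefixP[u ->]|nst] := boolP (prefix s t); last first.
  rewrite big1 // => y _; case: ifPn => // /(prefix_trans (prefix_rcons s y)).
  by rewrite (negPf nst).
case: u => [|z u].
  rewrite big1 ?cats0 // => y _; case: ifPn => // /size_prefix.
  by rewrite size_rcons ltnn.
have E y : prefix (rcons s y) (s ++ z :: u) = (y == z).
  by rewrite -cats1 prefix_catr // eqxx /= prefix0s andbT.
under eq_bigr do rewrite E.
have [zs|zs] := boolP (z \in move s); last first.
  rewrite big1_seq // => y /andP[_ ys]; case: eqP => // yz.
  by rewrite -yz ys in zs.
rewrite (bigD1_seq z) ?fset_uniq //= eqxx big1 ?adde0 // => y /negPf->//.
Qed.

(** Both the mass and the weight [c] carried by the sequences [t k] beyond a
    node are distributed over its successors. So a node whose mass exceeds the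
    weight carried beyond it has a successor with the same property, and the
    branch can be chosen greedily. Applied to nodes [t k] of mass at most [c k],
    this says that nodes of total mass less than that of [s] miss some branch
    through [s]; it replaces the construction of a measure on the space of
    branches. *)
Lemma branch_avoiding (t : nat -> seq T) (c : nat -> \bar R) s :
  node s -> (forall k, 0 <= c k)%E ->
  (\sum_(0 <= k <oo) c k < (mass s)%:E)%E ->
  exists x, [/\ branch x, mkseq x (size s) = s &
    forall k n, (size s <= n)%N -> t k = mkseq x n ->
      (c k < (mass (mkseq x n))%:E)%E].
Proof.
move=> ns c0 cs.
pose w s' k := if prefix s' (t k) then c k else 0%E.
have w0 s' k : (0 <= w s' k)%E by rewrite /w; case: ifP.
pose good s' := node s' /\ (\sum_(0 <= k <oo) w s' k < (mass s')%:E)%E.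
have gs : good s.
  split=> //; apply: le_lt_trans cs; apply: lee_nneseries => // k _.
  by rewrite /w; case: ifP.
have gstep s' : good s' -> exists2 y, y \in move s' & good (rcons s' y).
  move=> [ns' gs']; apply: contrapT => nex; move: gs'; apply/negP.
  rewrite -leNgt -sum_mass_rcons // -sumEFin.
  apply: (@le_trans _ _ (\sum_(y <- move s')
      \sum_(0 <= k <oo) w (rcons s' y) k)%E); last first.
    rewrite -nneseries_sum//; apply: lee_nneseries => k *; first exact: sume_ge0.
    exact: sum_children.
  rewrite big_seq [leRHS]big_seq; apply: lee_sum => y ys.
  rewrite leNgt; apply/negP => gy; apply: nex; exists y => //; split=> //.
  exact/node_rcons.
have [|k s' [gs' sk]|x [xs xg]] := @dependent_branch _
    (fun k s' => good s' /\ size s' = (size s + k)%N) s.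
- by rewrite addn0; split.
- have [y ys gy] := gstep _ gs'; exists y, [::].
  by rewrite cats1 size_rcons addnS sk.
have xgood n : (size s <= n)%N -> good (mkseq x n).
  move=> sn; have [m _ []] := xg (n - size s)%N.
  by rewrite size_mkseq subnKC // => ? <-.
exists x; split=> // [|k n sn tk].
  apply: node_branch => m; exists (size s + m)%N; first exact: leq_addl.
  by have [] := xgood _ (leq_addr m (size s)).
have [_] := xgood _ sn; apply: le_lt_trans.
rewrite (@nneseriesD1 _ _ k) // /w tk prefix_refl leeDl //.
by apply: nneseries_ge0 => *; rewrite -tk; exact: w0.
Qed.

(** A Baire category argument. If the bound failed below every node, for
    every constant, then nodes violating the bound for the constants
    1, 2, 3, ... could be found one beyond the other, and along the branch
    through all of them no constant would work. *)
Lemma uniform_mass_bound (f : nat -> R) : (forall n, 0 < f n) ->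
  (forall x, branch x -> exists C N,
     forall n, (N <= n)%N -> mass (mkseq x n) <= C * f n) ->
  exists s C, [/\ node s, 0 < C &
    forall t, node t -> prefix s t -> mass t <= C * f (size t)].
Proof.
move=> f0 fbd; apply: contrapT => nbd.
have large s C : node s -> 0 < C ->
    exists t, [/\ node t, prefix s t & C * f (size t) < mass t].
  move=> ns C0; apply: contrapT => nt; apply: nbd; exists s, C; split=> // t nt' st.
  by rewrite leNgt; apply/negP => Ct; apply: nt; exists t.
pose P k s := node s /\ ((0 < k)%N -> k%:R * f (size s) < mass s).
have [|k s [ns _]|x [_ xP]] := @dependent_branch _ P [::].
- by split=> //; exact: node_nil.
- (* the second summand of the constant keeps [t] different from [s] *)
  have C0 : 0 < k.+1%:R + mass s / f (size s).
    by rewrite ltr_pwDl ?ltr0n// divr_ge0 ?mass_ge0// ltW.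
  have [t [nt /prefixP[[|y u] tE] Ct]] := large s _ ns C0; rewrite {t}tE in nt Ct.
    move: Ct; rewrite cats0 mulrDl divfK ?gt_eqF// ltNge lerDr.
    by rewrite mulr_ge0// ltW.
  exists y, u; split=> // _; apply: le_lt_trans Ct.
  by rewrite ler_pM2r// lerDl divr_ge0 ?mass_ge0// ltW.
have [|C [N xN]] := fbd x.
  by apply: node_branch => m; have [n mn []] := xP m; exists n.
have [n] := xP (N + Num.bound `|C|).+1; rewrite add0n => kn [_ /(_ isT)].
rewrite size_mkseq; apply/negP; rewrite -leNgt.
apply: le_trans (xN n _) _; first by apply: leq_trans kn; rewrite -addnS leq_addr.
rewrite ler_pM2r// (le_trans (ler_norm C))// ltW//.
apply: lt_le_trans (archi_boundP (normr_ge0 C)) _.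
by rewrite ler_nat leqW// leq_addl.
Qed.

End Tree.

(** * The Euclidean distance *)

Section Edist.
Context (R : realType) (d : nat).
Implicit Types (u v w : 'rV[R]_d) (x : nat -> 'rV[R]_d).

Lemma edist_ge0 u v : 0 <= edist u v.
Proof. exact: sqrtr_ge0. Qed.

Lemma edistC u v : edist u v = edist v u.
Proof. by congr Num.sqrt; apply: eq_bigr => i _; rewrite -sqrrN opprB. Qed.

(** Expanding the sum of the squares of [B * a i - A * b i], where [A] and [B]
    are the norms of [a] and [b], gives the Cauchy-Schwarz inequality. *)
Lemma sqrt_sum_sqr_triangle (a b : 'I_d -> R) :
  Num.sqrt (\sum_i (a i + b i) ^+ 2)
    <= Num.sqrt (\sum_i a i ^+ 2) + Num.sqrt (\sum_i b i ^+ 2).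
Proof.
set A := Num.sqrt (\sum_i a i ^+ 2); set B := Num.sqrt (\sum_i b i ^+ 2).
have A0 : 0 <= A by exact: sqrtr_ge0.
have B0 : 0 <= B by exact: sqrtr_ge0.
have AE : A ^+ 2 = \sum_i a i ^+ 2.
  by rewrite sqr_sqrtr// sumr_ge0// => i _; exact: sqr_ge0.
have BE : B ^+ 2 = \sum_i b i ^+ 2.
  by rewrite sqr_sqrtr// sumr_ge0// => i _; exact: sqr_ge0.
have zero (c : 'I_d -> R) : \sum_i c i ^+ 2 = 0 -> forall i, c i = 0.
  move=> /eqP; rewrite psumr_eq0 => [/allP c0 i|i _]; last exact: sqr_ge0.
  by apply/eqP; rewrite -sqrf_eq0; apply: c0; rewrite mem_index_enum.
have CS : \sum_i a i * b i <= A * B.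
  have [A_eq0|A_neq0] := eqVneq A 0.
    rewrite A_eq0 mul0r big1// => i _; rewrite (zero a) ?mul0r//.
    by rewrite -AE A_eq0 expr0n.
  have [B_eq0|B_neq0] := eqVneq B 0.
    rewrite B_eq0 mulr0 big1// => i _; rewrite (zero b) ?mulr0//.
    by rewrite -BE B_eq0 expr0n.
  have AB0 : 0 < A * B by rewrite mulr_gt0// lt_neqAle eq_sym ?A_neq0 ?B_neq0.
  have : 0 <= \sum_i (B * a i - A * b i) ^+ 2.
    by apply: sumr_ge0 => i _; exact: sqr_ge0.
  have -> : \sum_i (B * a i - A * b i) ^+ 2 =
      B ^+ 2 * A ^+ 2 + A ^+ 2 * B ^+ 2 - 2 * (A * B) * \sum_i a i * b i.
    rewrite {1}AE {2}BE !mulr_sumr -big_split/= -sumrB; apply: eq_bigr => i _.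
    by ring.
  move=> h; rewrite -(ler_pM2l AB0); nra.
rewrite -(@ler_pXn2r _ 2) ?nnegrE ?sqrtr_ge0 ?addr_ge0//.
rewrite sqr_sqrtr; last by apply: sumr_ge0 => i _; exact: sqr_ge0.
under eq_bigr do rewrite sqrrD.
rewrite !big_split/= -AE -BE sqrrD lerD2r lerD2l.
by rewrite mulr2n lerD.
Qed.

Lemma edist_triangle v u w : edist u w <= edist u v + edist v w.
Proof.
apply: le_trans (sqrt_sum_sqr_triangle _ _); rewrite le_eqVlt; apply/orP; left.
by apply/eqP; congr Num.sqrt; apply: eq_bigr => i _; rewrite addrA subrK.
Qed.

Lemma norm_le_edist u v : `|u - v| <= edist u v.
Proof.
rewrite [leLHS]mx_normrE; apply/bigmax_leP; split=> [|[i j] _ /=].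
  exact: edist_ge0.
rewrite ord1 !mxE -sqrtr_sqr; apply: ler_wsqrtr.
by rewrite (bigD1 j)//= lerDl sumr_ge0// => k _; exact: sqr_ge0.
Qed.

Lemma edist_le_norm u v : edist u v <= d%:R * `|u - v|.
Proof.
rewrite -(@ler_pXn2r _ 2) ?nnegrE ?edist_ge0 ?mulr_ge0//.
rewrite sqr_sqrtr; last by apply: sumr_ge0 => i _; exact: sqr_ge0.
apply: (@le_trans _ _ (d%:R * `|u - v| ^+ 2)); last first.
  rewrite exprMn ler_wpM2r ?exprn_ge0// -natrX ler_nat.
  by case: (d) => // n; rewrite -mulnn leq_pmulr.
have -> : d%:R * `|u - v| ^+ 2 = \sum_(i < d) `|u - v| ^+ 2.
  by rewrite sumr_const card_ord mulr_natl.
apply: ler_sum => i _.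
rewrite -real_normK ?num_real// lerXn2r ?nnegrE//.
rewrite [leRHS]mx_normrE; apply: le_trans (le_bigmax _ _ (ord0, i)).
by rewrite !mxE.
Qed.

Lemma cvg_edistP x u :
  x @ \oo --> u <-> forall e, 0 < e -> \forall n \near \oo, edist (x n) u < e.
Proof.
split=> [/cvgrPdist_lt xu e e0|xu].
  have e1 : 0 < e / (d%:R + 1) by rewrite divr_gt0// ltr_wpDl.
  near=> n; apply: le_lt_trans (edist_le_norm _ _) _.
  have : `|u - x n| < e / (d%:R + 1) by near: n; exact: xu.
  rewrite distrC ltr_pdivlMr ?ltr_wpDl// => /(le_lt_trans _); apply.
  by rewrite mulrC ler_wpM2l// lerDl.
apply/cvgrPdist_lt => e e0; near=> n.
rewrite distrC; apply: le_lt_trans (norm_le_edist _ _) _.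
by near: n; exact: xu.
Unshelve. all: by end_near. Qed.

Lemma nbhs_edist u e : 0 < e -> nbhs u [set v | edist u v < e].
Proof.
move=> e0; have e1 : 0 < e / (d%:R + 1) by rewrite divr_gt0// ltr_wpDl.
apply/nbhs_ballP; exists (e / (d%:R + 1)) => //= v.
rewrite mx_norm_ball /ball_/= => uv.
apply: le_lt_trans (edist_le_norm _ _) _.
move: uv; rewrite ltr_pdivlMr ?ltr_wpDl// => /(le_lt_trans _); apply.
by rewrite mulrC ler_wpM2l// lerDl.
Qed.

End Edist.

(** * The tree of positions *)

Lemma limn_esup_bounded (R : realType) (u : nat -> R) (c : R) :
  (limn_esup (fun n => (u n)%:E) <= c%:E)%E ->
  exists N, forall n, (N <= n)%N -> u n <= c + 1.
Proof.
rewrite /limn_esup limf_esupE => /le_lt_trans h.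
have /h/ereal_inf_lt[_ [V [N _ NV] <-] ltV] : (c%:E < (c + 1)%:E)%E.
  by rewrite lte_fin ltrDl.
exists N => n Nn; rewrite -lee_fin ltW//; apply: le_lt_trans ltV.
by apply: ereal_sup_ubound; exists n => //; exact: NV.
Qed.

Section Game.
Context (R : realType) (d : nat).
Variables (delta rho0 : R) (beta : R^nat) (A : set 'rV[R]_d).
Variable sigma : strategy_I R d.
Hypothesis delta_gt0 : 0 < delta.
Hypothesis adm : admissible rho0 beta.
Hypothesis win : winning_I delta rho0 beta A sigma.
Implicit Types (s t : seq 'rV[R]_d) (x z : nat -> 'rV[R]_d) (a b : 'rV[R]_d).

Local Notation rho := (rho rho0 beta).

Lemma beta_gt0 n : 0 < beta n.
Proof.
case: adm => _ bd _ _; have [/andP[b0 b1] _] := bd n.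
exact: lt_le_trans b0 b1.
Qed.

Lemma beta_lt n : beta n < 2^-1.
Proof. by case: adm => _ /(_ n)[]. Qed.

Lemma rho0_gt0 : 0 < rho0. Proof. by case: adm. Qed.

Lemma rhoS n : rho n.+1 = beta n * rho n.
Proof. by rewrite /Defs.rho big_ord_recr/= mulrAC mulrC. Qed.

Lemma rho_gt0 n : 0 < rho n.
Proof.
by rewrite mulr_gt0 ?rho0_gt0// prodr_gt0// => i _; exact: beta_gt0.
Qed.

Lemma rho_lt_halfS n : rho n.+1 < 2^-1 * rho n.
Proof. by rewrite rhoS ltr_pM2r ?rho_gt0// beta_lt. Qed.

Lemma rho_le m n : (m <= n)%N -> rho n <= rho m.
Proof.
move=> /subnK<-; elim: (n - m)%N => // k IH; rewrite addSn.
apply: le_trans IH; have := rho_lt_halfS (k + m); have := rho_gt0 (k + m).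
lra.
Qed.

Lemma rho_small e m : 0 < e -> exists2 n, (m <= n)%N & rho n < e.
Proof.
move=> e0; have geo n : rho n <= 2^-1 ^+ n * rho0.
  elim: n => [|n IH]; first by rewrite /Defs.rho big_ord0.
  rewrite exprS -mulrA; apply: le_trans (ltW (rho_lt_halfS n)) _.
  by rewrite ler_pM2l.
have : 2^-1 ^+ n @[n --> \oo] --> (0 : R).
  by apply: cvg_expr; rewrite ger0_norm ?invr_ge0// invf_lt1// ltr1n.
have e1 : 0 < e / rho0 by rewrite divr_gt0// rho0_gt0.
move=> /cvgrPdist_lt/(_ _ e1)[N _ hN]; exists (maxn m N); first exact: leq_maxl.
apply: le_lt_trans (geo _) _; rewrite -ltr_pdivlMr ?rho0_gt0//.
have := hN (maxn m N) (leq_maxr _ _).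
by rewrite sub0r normrN ger0_norm// exprn_ge0// invr_ge0.
Qed.

Lemma prod_beta_powR n :
  \prod_(i < n) (beta i `^ delta) = (rho n / rho0) `^ delta.
Proof.
rewrite /Defs.rho mulfK ?gt_eqF ?rho0_gt0//.
elim: n => [|n IH]; first by rewrite !big_ord0 powR1.
rewrite !big_ord_recr/= IH powRM//; last exact/ltW/beta_gt0.
by apply: prodr_ge0 => i _; exact/ltW/beta_gt0.
Qed.

(** Once player I follows [sigma], a position is determined by the moves of
    player II; the positions without illegal moves are the nodes of the tree
    in which [reply s] is the set of successors of [s]. *)
Definition history s : seq ({fset 'rV[R]_d} * 'rV[R]_d) :=
  foldl (fun h y => rcons h (sigma h, y)) [::] s.

Definition reply s := sigma (history s).

Lemma history_mkseq x n :
  history (mkseq x n) = mkseq (fun i => (reply (mkseq x i), x i)) n.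
Proof.
elim: n => [//|n IH]; rewrite [RHS]mkseqS -IH mkseqS /history -cats1 foldl_cat.
by [].
Qed.

Lemma reply_wins x : I_wins delta rho0 beta A (fun i => reply (mkseq x i)) x.
Proof. by apply: win => n; rewrite -history_mkseq. Qed.

Lemma reply_legal x m : node reply (mkseq x m) ->
  legal_I rho0 beta (fun i => reply (mkseq x i)) x m.
Proof.
move=> nx; have [[n [lI _ nII]]|[]//] := reply_wins x.
have [/lI//|nm] := leqP m n.
by case: nII; apply: nx; rewrite -mkseqS; exact: prefix_mkseq.
Qed.

Lemma branch_wins x : branch reply x ->
  size_rule delta beta (fun i => reply (mkseq x i)) /\
  exists2 a, A a & x @ \oo --> a.
Proof. by move=> bx; have [[n [_ _ /(_ (bx n))]]|[]] := reply_wins x. Qed.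

Lemma reply_neq0 s : node reply s -> reply s != fset0.
Proof.
move=> ns; have := @reply_legal (nth 0 s) (size s).
by rewrite mkseq_nth => /(_ ns)[+ _ _ _]; rewrite mkseq_nth.
Qed.

(** * Limits of branches *)

Lemma branch_edist x m n : branch reply x -> (m <= n)%N ->
  edist (x m) (x n) <= rho m - rho n.
Proof.
move=> bx /subnK<-; elim: (n - m)%N => [|k IH].
  rewrite subrr /edist big1 ?sqrtr0// => i _.
  by rewrite subrr expr0n.
apply: le_trans (edist_triangle (x (k + m)%N) _ _) _.
have [_ _ _ /(_ _ erefl)] := reply_legal (@branch_node _ _ _ (k + m).+1 bx).
move=> /(_ _ (bx (k + m).+1)); rewrite /eball/= mulrBl mul1r -rhoS addSn.
by move=> h; lra.
Qed.

Lemma branch_edist_lim x a n : branch reply x -> x @ \oo --> a ->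
  edist (x n) a <= rho n.
Proof.
move=> bx xa; apply/ler_addgt0Pr => e e0.
have [N _ hN] := (cvg_edistP _ _).1 xa _ e0.
apply: le_trans (edist_triangle (x (maxn n N)) _ _) _.
have := branch_edist bx (leq_maxl n N); have := rho_gt0 (maxn n N).
have := hN (maxn n N) (leq_maxr n N).
by rewrite /= => h1 h2 h3; lra.
Qed.

(** The separation of the moves of player I forces branches with close limits
    to share an initial segment: after a first difference at the choice number
    [i] the limits lie in balls of radius [rho i] about points at distance at
    least [3 * rho i]. *)
Lemma branch_eq x z a b n : branch reply x -> branch reply z ->
  x @ \oo --> a -> z @ \oo --> b -> edist a b < rho n ->
  mkseq x n.+1 = mkseq z n.+1.
Proof.
move=> bx bz xa zb abn.
suff E m : (m <= n.+1)%N -> mkseq x m = mkseq z m by exact: E.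
elim: m => [//|m IH mn]; rewrite !mkseqS; have e := IH (ltnW mn).
rewrite e; congr rcons; apply/eqP; apply: contrapT => /negP xz.
have [_ _ sep _] := reply_legal (@branch_node _ _ _ m bz).
have := sep _ _ _ (bz m) xz; rewrite -{1}e => /(_ (bx m)).
have := branch_edist_lim m bx xa; have := branch_edist_lim m bz zb.
rewrite edistC => h1 h2 h3; have := rho_le (mn : (m <= n)%N).
have := edist_triangle a (x m) (z m); have := edist_triangle b a (z m).
by move=> h4 h5 h6; lra.
Qed.

Definition limit_set : set 'rV[R]_d :=
  [set a | exists2 x, branch reply x & x @ \oo --> a].

Lemma limit_set_sub : limit_set `<=` A.
Proof.
move=> a [x /branch_wins[_ [b Ab xb]] xa].
by rewrite (cvg_unique _ xa xb).
Qed.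

Lemma limit_set_bounded : bounded_set limit_set.
Proof.
exists (\sum_(y <- reply [::]) `|y| + rho 0); split; first exact: num_real.
move=> M ltM a [x bx xa]; apply: ltW; apply: le_lt_trans ltM.
have -> : a = x 0%N - (x 0%N - a) by rewrite opprB addrC subrK.
apply: le_trans (ler_normB _ _) _; apply: lerD; last first.
  exact: le_trans (norm_le_edist _ _) (branch_edist_lim _ bx xa).
rewrite (bigD1_seq (x 0%N)) ?fset_uniq ?(bx 0%N)//= lerDl.
exact: sumr_ge0.
Qed.

(** If the limits of branches [z n] tend to [a] fast enough, then by
    [branch_eq] the branch [z n] shares its first [n.+1] choices with all later
    ones, and the diagonal branch has limit [a]. *)
Lemma limit_set_closed : closed limit_set.
Proof.
rewrite closure_id; apply/seteqP; split; first exact: subset_closure.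
move=> a cla.
have /choice[z zP] n : exists z, branch reply z /\
    exists2 b, z @ \oo --> b & edist a b < rho n / 2.
  have [|b [[z bz zb] ab]] := cla _ (nbhs_edist a (e := rho n / 2) _).
    by rewrite divr_gt0// rho_gt0.
  by exists z; split=> //; exists b.
have zz m n : (m <= n)%N -> mkseq (z m) m.+1 = mkseq (z n) m.+1.
  move=> mn; have [bm [b mb ab]] := zP m; have [bn [c nc ac]] := zP n.
  apply: branch_eq mb nc _ => //.
  have := edist_triangle a b c; rewrite (edistC b a); have := rho_le mn.
  by move=> h1 h2; lra.
pose x n := z n n.
have xz n : mkseq x n.+1 = mkseq (z n) n.+1.
  apply/eq_in_map => i; rewrite mem_iota add0n => /andP[_ ilt].
  by have := zz i n ilt; rewrite !mkseqS => /rcons_inj[_ <-].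
exists x => [n|].
  have [bn _] := zP n; have := xz n; rewrite !mkseqS => /rcons_inj[->].
  exact: bn n.
apply/cvg_edistP => e e0; have [|N _ rN] := @rho_small (e / 2) 0.
  by rewrite divr_gt0.
near=> n; have [bn [b nb ab]] := zP n.
have := branch_edist_lim n bn nb; have := edist_triangle b (z n n) a.
have : rho n <= rho N by apply: rho_le; near: n; exact: nbhs_infty_ge.
rewrite (edistC b a) -/(x n) => h1 h2 h3; lra.
Unshelve. all: by end_near. Qed.

Lemma limit_set_compact : compact limit_set.
Proof. exact: bounded_closed_compact limit_set_bounded limit_set_closed. Qed.

Local Notation mass := (@mass R _ reply).

(** * The dimension of the limit set *)

(** The rule on the number of moves is the bound on the mass along a branch that
    [uniform_mass_bound] asks for, because the products of the
    [beta i `^ delta] are powers of [rho] up to a constant factor. *)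
Lemma mass_le_rho : exists s C, [/\ node reply s, 0 < C &
  forall t, node reply t -> prefix s t -> mass t <= C * rho (size t) `^ delta].
Proof.
apply: (@uniform_mass_bound R _ reply (fun n => rho n `^ delta)) => [n|x bx].
  exact: powR_gt0 (rho_gt0 n).
have [[c c0 /limn_esup_bounded[N hN]] _] := branch_wins bx.
exists ((c + 1) * rho0^-1 `^ delta), N => n Nn.
have := hN n Nn; rewrite prod_beta_powR ler_pdivrMr; last first.
  by rewrite powR_gt0// divr_gt0 ?rho_gt0 ?rho0_gt0.
rewrite powRM ?invr_ge0 ?(ltW (rho_gt0 n)) ?(ltW rho0_gt0)// => h.
rewrite -mulrA (mulrC (rho0^-1 `^ _)); apply: le_trans h.
rewrite le_eqVlt; apply/orP; left; apply/eqP.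
rewrite /mass size_mkseq; apply: eq_bigr => i _.
by rewrite -map_take take_iota (minn_idPl (ltnW (ltn_ord i))).
Qed.

(** Let [r] be the larger of [D] and [tau `^ delta^-1]. For the least
    [n >= size s] with [rho n.+1 <= r] also [D < rho n]; hence all branches
    through [s] with limit in [U] share their first [n.+1] choices, and the
    node so determined has mass at most [C * rho n.+1 `^ delta], which is at
    most [C * r `^ delta]. The term [tau] is there for [D = 0], when no level is
    the last one with [D < rho n]. *)
Lemma small_set_node s C (U : set 'rV[R]_d) (D tau : R) :
  node reply s -> 0 < C ->
  (forall t, node reply t -> prefix s t ->
    mass t <= C * rho (size t) `^ delta) ->
  (forall a b, U a -> U b -> edist a b <= D) -> 0 <= D -> D < rho (size s) ->
  0 < tau ->
  exists t, forall x a, branch reply x -> mkseq x (size s) = s ->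
    x @ \oo --> a -> U a ->
    exists n, [/\ (size s <= n)%N, t = mkseq x n &
      mass t <= C * (D `^ delta + tau)].
Proof.
move=> ns C0 sC UD D0 Ds tau0.
have [[x [a [bx xs xa Ua]]]|nex] := pselect (exists x a,
    [/\ branch reply x, mkseq x (size s) = s, x @ \oo --> a & U a]); last first.
  by exists [::] => x a bx xs xa Ua; case: nex; exists x, a.
pose r := Num.max D (tau `^ delta^-1).
have r0 : 0 < r by rewrite lt_max powR_gt0 ?orbT.
have rdelta : r `^ delta <= D `^ delta + tau.
  rewrite /r; have [_|_] := leP D _; last by rewrite lerDl ltW.
  by rewrite -powRrM mulVf ?gt_eqF// powRr1 ?lerDr ?powR_ge0// ltW.
have exn : exists n, (size s <= n)%N && (rho n.+1 <= r).
  have [n sn nr] := rho_small (size s) r0; exists n; rewrite sn/=.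
  exact: le_trans (rho_le (leqnSn n)) (ltW nr).
pose n := ex_minn exn.
have [sn nr Dn] : [/\ (size s <= n)%N, rho n.+1 <= r & D < rho n].
  rewrite /n; case: ex_minnP => m /andP[sm mr] mmin; split=> //.
  move: sm; rewrite leq_eqVlt => /predU1P[<-//|].
  case: m {mr} mmin => // m mmin; rewrite ltnS => sm.
  have : ~~ (rho m.+1 <= r).
    by apply/negP => mr; have := mmin m; rewrite sm mr ltnn => /(_ isT).
  by rewrite -ltNge; apply: le_lt_trans; rewrite le_max lexx.
exists (mkseq x n.+1) => z b bz zs zb Ub; exists n.+1; split.
- exact: leqW.
- by apply: branch_eq xa zb _ => //; exact: le_lt_trans (UD _ _ Ua Ub) Dn.
- apply: le_trans (sC _ (@branch_node _ _ _ n.+1 bx) _) _.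
    by rewrite -[X in prefix X _]xs; apply: prefix_mkseq; exact: leqW.
  rewrite size_mkseq ler_pM2l//; apply: le_trans rdelta.
  by apply: ge0_ler_powR; rewrite ?nnegrE ?(ltW delta_gt0) ?(ltW r0)
    ?(ltW (rho_gt0 _)).
Qed.

(** The mass distribution principle: a cover of the limit set by small sets
    of small total weight would give nodes of small total mass, and
    [branch_avoiding] a branch whose limit is not covered. *)
Lemma hausdorff_dim_limit_set : (delta%:E <= hausdorff_dim limit_set)%E.
Proof.
have [s [C [ns C0 sC]]] := mass_le_rho.
apply: le_ereal_inf_tmp => _ [q [q0 Hq0] <-]; rewrite lee_fin leNgt.
apply/negP => q_delta.
pose e := Num.min 1 (rho (size s) / 2).
have e0 : 0 < e by rewrite lt_min ltr01/= divr_gt0// rho_gt0.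
have e1 : e <= 1 by rewrite ge_min lexx.
have es : e < rho (size s).
  by rewrite gt_min; apply/orP; right; have := rho_gt0 (size s); lra.
(* chosen so that the total mass found below is less than
   [C * (eps + eps) = mass s] *)
pose eps := mass s / (2 * C).
have eps0 : 0 < eps by rewrite divr_gt0 ?mulr_gt0// mass_gt0//; exact: reply_neq0.
have : (hausdorff_premeasure q e limit_set < eps%:E)%E.
  apply: (@le_lt_trans _ _ 0%E); last by rewrite lte_fin.
  by rewrite -Hq0; apply: ereal_sup_ubound; exists e.
move=> /ereal_inf_lt[_ [U [KU Ue] <-] Ueps].
have w0 k : (0 <= hausdorff_weight q (U k))%E.
  by rewrite /hausdorff_weight; case: ifP => // _; exact: poweR_ge0.
pose tau k : R := eps / (2 ^ k.+1)%:R.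
have tau0 k : 0 < tau k by rewrite divr_gt0// ltr0n expn_gt0.
pose c k := (C%:E * (hausdorff_weight q (U k) + (tau k)%:E))%E.
have c0 k : (0 <= c k)%E.
  by rewrite mule_ge0 ?lee_fin ?(ltW C0)// adde_ge0// lee_fin ltW.
have cs : (\sum_(0 <= k <oo) c k < (mass s)%:E)%E.
  rewrite nneseriesZl; last by move=> k _; rewrite adde_ge0// lee_fin ltW.
  have -> : mass s = C * (eps + eps).
    by rewrite /eps; field; rewrite gt_eqF.
  rewrite EFinM lte_pmul2l ?lte_fin//.
  apply: le_lt_trans (epsilon_trick xpredT w0 (ltW eps0)) _.
  by rewrite EFinD lteD2rE.
have /choice[t tP] k : exists t, forall x a, branch reply x ->
    mkseq x (size s) = s -> x @ \oo --> a -> U k a ->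
    exists n, [/\ (size s <= n)%N, t = mkseq x n & ((mass t)%:E <= c k)%E].
  have [Uk0|/set0P[a0 Ua0]] := eqVneq (U k) set0.
    by exists [::] => x a; rewrite Uk0.
  have Dub a b : U k a -> U k b -> ((edist a b)%:E <= ediam (U k))%E.
    by move=> Ua Ub; apply: ereal_sup_ubound; exists (a, b).
  have [D DE] : exists D, ediam (U k) = D%:E.
    have := Ue k; have := Dub _ _ Ua0 Ua0.
    by case: (ediam _) => // D _ _; exists D.
  have De : D <= e by have := Ue k; rewrite DE lee_fin.
  have UD a b : U k a -> U k b -> edist a b <= D.
    by move=> Ua Ub; rewrite -lee_fin -DE; exact: Dub.
  have D0 : 0 <= D := le_trans (edist_ge0 a0 a0) (UD _ _ Ua0 Ua0).
  have [t ht] := small_set_node ns C0 sC UD D0 (le_lt_trans De es) (tau0 k).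
  exists t => x a bx xs xa Ua; have [n [sn tn tm]] := ht x a bx xs xa Ua.
  exists n; split=> //; apply: (@le_trans _ _ (C * (D `^ delta + tau k))%:E).
    by rewrite lee_fin.
  rewrite /c EFinM lee_pmul2l ?lte_fin// EFinD leeD2rE//.
  rewrite /hausdorff_weight ifF; last by apply/negP => /eqP Uk0; rewrite Uk0 in Ua0.
  rewrite DE poweR_EFin lee_fin.
  move: D0; rewrite le_eqVlt => /predU1P[<-|D0].
    by rewrite powR0 ?powR_ge0// gt_eqF.
  by apply: ger_powR; [rewrite D0 (le_trans De) | exact: ltW].
have [x [bx xs xavoid]] := branch_avoiding reply_neq0 t ns c0 cs.
have [_ [a _ xa]] := branch_wins bx.
have [k _ Uka] := KU a (ex_intro2 _ _ x bx xa).
have [n [sn tn tc]] := tP k x a bx xs xa Uka.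
by have := xavoid k n sn tn; rewrite -tn ltNge tc.
Qed.

End Game.

Theorem theorem2 (R : realType) (d : nat) (A : set 'rV[R]_d)
    (delta rho0 : R) (beta : R^nat)
    (d_ge1 : (1 <= d)%N)
    (delta_gt0 : 0 < delta) (delta_le : delta <= d%:R)
    (adm : admissible rho0 beta)
    (win : I_has_winning_strategy delta rho0 beta A) :
  exists K : set 'rV[R]_d,
    [/\ compact K, K `<=` A & (delta%:E <= hausdorff_dim K)%E].
Proof.
have [sigma win_sigma] := win.
exists (limit_set sigma); split.
- exact: limit_set_compact adm win_sigma.
- exact: limit_set_sub win_sigma.
- exact: hausdorff_dim_limit_set delta_gt0 adm win_sigma.
Qed.
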